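(* Let $d,c,n$ be positive integers with $d\geq 4c$ and $d\mid n$. Then $$m(n,2^{d-1}-c)=\frac{n}{d}\left(2^d-c\right).$$
   Context: For a finite set $V$, a family $\mathcal{F}\subseteq 2^V$ and $T\subseteq V$, the trace of $\mathcal{F}$ on $T$ is $\mathcal{F}_{|T}=\{F\cap T: F\in\mathcal{F}\}$. For integers $n,m,a,b$ write $(n,m)\rightarrow(a,b)$ if for every $n$-element set $V$ and every family $\mathcal{F}\subseteq 2^V$ with $|\mathcal{F}|\geq m$ there is an $a$-element set $T\subseteq V$ with $|\mathcal{F}_{|T}|\geq b$. For non-negative integers $n$ and $s$, $m(n,s)$ denotes the maximum value such that for every $m\leq m(n,s)$ we have $(n,m)\rightarrow(n-1,m-s)$. Equivalently, $m(n,s)$ is the largest number such that every family $\mathcal{H}$ of subsets of an $n$-set $V$ with at most $m(n,s)$ members has a vertex $x$ with $|\{H\setminus\{x\}:H\in\mathcal{H}\}|\geq|\mathcal{H}|-s$. *)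

(* Defs.v *)
From mathcomp Require Import all_boot.

Set Implicit Arguments.
Unset Strict Implicit.
Unset Printing Implicit Defensive.

Definition trace (V : finType) (F : {set {set V}}) (T : {set V}) :
  {set {set V}} := [set A :&: T | A in F].

(* (n, m) -> (a, b) *)
Definition arrow (n m a b : nat) : Prop :=
  forall V : finType, #|V| = n ->
  forall F : {set {set V}}, m <= #|F| ->
  exists2 T : {set V}, #|T| = a & b <= #|trace F T|.

(* The truncation of m - s is harmless: like any bound b <= 0, the bound 0 in
   arrow only asks for some T of the right size. *)
Definition arrow_upto (n s M : nat) : Prop :=
  forall m : nat, m <= M -> arrow n m (n - 1) (m - s).

(* m(n, s) = M, as a relation: M is the maximum of the set of values M'
   satisfying arrow_upto n s M'. That set is all of nat when 2 ^ (n - 1) <= s,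
   in which case no M satisfies the relation. *)
Definition is_m (n s M : nat) : Prop :=
  arrow_upto n s M /\ (forall M' : nat, arrow_upto n s M' -> M' <= M).

(* Main.v *)
Require Import Defs.
From mathcomp Require Import all_boot all_order all_algebra.
From mathcomp Require Import zify ring lra.

(** A coordinatewise compression makes the family [F] a down-set without
    enlarging any trace, and for a down-set the trace on the complement of [x]
    loses exactly the members through [x].  So one has to show that a down-set
    with all degrees larger than [2 ^ (d - 1) - c] has more than
    [n / d * (2 ^ d - c)] members.  Give [x] the weight, summed over the members
    [A] through [x], of [1 / #|A|]; the weights add up to [#|F| - 1], so it
    suffices that they are at least [t = (2 ^ d - c) / d] on average.

    Sums of a decreasing function of [#|A|] over a down-set [L] are bounded below
    by a concave function of [#|L|] that is exact on cubes.  It follows that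
    [x] has weight at least [t] unless its link has only [d - 1] vertices.  In
    that case [x] and its neighbours form a block of [d] vertices spanning almost
    all of its [2 ^ d] subsets, and the weights on a block always sum up to at
    least [2 ^ d - c].  A vertex shared by several blocks has an enormous weight,
    which makes up for all deficits in these blocks.

    The extremal family consists of [n / d] disjoint copies of a down-set of
    [2 ^ d - c + 1] subsets of a [d]-set. *)

Set Implicit Arguments.
Unset Strict Implicit.
Unset Printing Implicit Defensive.
Import Order.TTheory GRing.Theory Num.Theory.
Local Open Scope ring_scope.

(** * The concave comparison function [psi] *)

(* The average of [g (j + #|A|)] over all subsets [A] of a [k]-set. *)
Fixpoint mu (g : nat -> rat) (k j : nat) : rat :=
  if k is k'.+1 then (mu g k' j + mu g k' j.+1) / 2 else g j.

Definition tau (g : nat -> rat) (j i : nat) : rat :=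
  if i is 0%N then g j else mu g (trunc_log 2 i) j.+1.

(* The piecewise linear function of [m] that takes the value [2 ^ k * mu g k j]
   at [m = 2 ^ k]; [tau g j] lists its increments. *)
Definition psi (g : nat -> rat) (j m : nat) : rat := \sum_(i < m) tau g j i.

Lemma mu_antitone_r (g : nat -> rat) (gA : forall i, g i.+1 <= g i) k j :
  mu g k j.+1 <= mu g k j.
Proof.
elim: k j => [|k IH] j //=.
by have := IH j; have := IH j.+1; lra.
Qed.

Lemma mu_antitone_l (g : nat -> rat) (gA : forall i, g i.+1 <= g i) j k l :
  (k <= l)%N -> mu g l j <= mu g k j.
Proof.
move=> /subnK <-; elim: (l - k)%N => [|e IH] //=.
by have := mu_antitone_r gA (e + k) j; lra.
Qed.

(** This is the concavity of [psi g j]: larger cubes average [g] over larger sets. *)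
Lemma tau_antitone (g : nat -> rat) (gA : forall i, g i.+1 <= g i) j i i' :
  (i <= i')%N -> tau g j i' <= tau g j i.
Proof.
case: i i' => [|i] [|i'] //= le_ii'; last first.
  by apply: mu_antitone_l => //; apply: leq_trunc_log.
apply: le_trans (gA j); exact: (@mu_antitone_l g gA j.+1 0).
Qed.

(** For positive [i], both [i.*2] and [i.*2.+1] lie one dyadic level above [i], and one step of the
    recursion of [mu] splits their common value. *)
Lemma tau_double (g : nat -> rat) j i :
  tau g j i.*2 + tau g j i.*2.+1 = tau g j i + tau g j.+1 i.
Proof.
case: i => [|i] //.
rewrite /tau doubleS -doubleS.
have E : trunc_log 2 i.+1.*2 = (trunc_log 2 i.+1).+1 by apply: trunc_log2_double.
have E' : trunc_log 2 i.+1.*2.+1 = (trunc_log 2 i.+1).+1.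
  by rewrite trunc_log2S; [congr (trunc_log 2 _).+1; lia | lia].
rewrite E E' /=; lra.
Qed.

Lemma psi0 (g : nat -> rat) j : psi g j 0 = 0.
Proof. by rewrite /psi big_ord0. Qed.

Lemma psiS (g : nat -> rat) j m : psi g j m.+1 = psi g j m + tau g j m.
Proof. by rewrite /psi big_ord_recr. Qed.

(** Counterpart, for [psi], of joining a family of [b] sets with its copy in which a new vertex is
    added to every set. *)
Lemma psi_double (g : nat -> rat) j b :
  psi g j b.*2 = psi g j b + psi g j.+1 b.
Proof.
elim: b => [|b IH]; first by rewrite !psi0 addr0.
rewrite doubleS !psiS IH.
by have := tau_double g j b; lra.
Qed.

Lemma psi_add (g : nat -> rat) j a b :
  psi g j (a + b) = psi g j a + \sum_(i < b) tau g j (a + i).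
Proof. by rewrite /psi big_split_ord. Qed.

(* The concave function [psi g j] satisfies [psi_double], so the difference of
   the two sides is nondecreasing in [a] and vanishes at [a = b]. *)
Lemma psi_subadditive (g : nat -> rat) (gA : forall i, g i.+1 <= g i) j a b :
  (b <= a)%N -> psi g j (a + b) <= psi g j a + psi g j.+1 b.
Proof.
move=> le_ba; rewrite psi_add lerD2l.
have -> : psi g j.+1 b = \sum_(i < b) tau g j (b + i).
  by have := psi_double g j b; rewrite -addnn psi_add; lra.
by apply: ler_sum => i _; apply: tau_antitone; rewrite // leq_add2r.
Qed.

Lemma psi_pow2 (g : nat -> rat) j k : psi g j (2 ^ k) = 2 ^+ k * mu g k j.
Proof.
elim: k j => [|k IH] j; first by rewrite /psi big_ord1 expr0 mul1r.
by rewrite expnS mul2n psi_double !IH exprS /=; field.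
Qed.

Lemma tau_pow2 (g : nat -> rat) j k i : (2 ^ k <= i < 2 ^ k.+1)%N ->
  tau g j i = mu g k j.+1.
Proof.
move=> H; have i0 : (0 < i)%N.
  by case/andP: H => + _; apply: leq_trans; rewrite expn_gt0.
by case: i i0 H => // i _ H; rewrite /tau (@trunc_log_eq 2 k).
Qed.

(** From [2 ^ k] up to [2 ^ k.+1] all increments equal [mu g k j.+1], so one can count down from the
    full cube. *)
Lemma psi_linear (g : nat -> rat) j k e : (e <= 2 ^ k)%N ->
  psi g j (2 ^ k.+1 - e) = 2 ^+ k.+1 * mu g k.+1 j - e%:R * mu g k j.+1.
Proof.
move=> He; rewrite -psi_pow2.
have {2}-> : (2 ^ k.+1 = (2 ^ k.+1 - e) + e)%N.
  by rewrite subnK // (leq_trans He) // leq_exp2l.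
rewrite psi_add (eq_bigr (fun=> mu g k j.+1)) => [|i _].
  by rewrite sumr_const card_ord -[_ *+ e]mulr_natl addrK.
have ? := ltn_ord i; apply: tau_pow2; rewrite expnS in He *; lia.
Qed.

(** * Sums over down-sets *)

Definition downset (V : finType) (F : {set {set V}}) : Prop :=
  forall A B : {set V}, A \in F -> B \subset A -> B \in F.

Definition link (V : finType) (x : V) (F : {set {set V}}) : {set {set V}} :=
  [set A : {set V} | (x \notin A) && (x |: A \in F)].

Definition deletion (V : finType) (x : V) (F : {set {set V}}) : {set {set V}} :=
  [set A : {set V} in F | x \notin A].

Lemma link_downset (V : finType) (x : V) (F : {set {set V}}) :
  downset F -> downset (link x F).
Proof.
move=> dF A B; rewrite !inE => /andP[xA AF] sBA.
apply/andP; split; first by apply: contra xA; apply: (subsetP sBA).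
by apply: dF AF _; apply: setUS.
Qed.

Lemma deletion_downset (V : finType) (x : V) (F : {set {set V}}) :
  downset F -> downset (deletion x F).
Proof.
move=> dF A B; rewrite !inE => /andP[AF xA] sBA.
by rewrite (dF _ _ AF sBA); apply: contra xA; apply: (subsetP sBA).
Qed.

Lemma link_sub_deletion (V : finType) (x : V) (F : {set {set V}}) :
  downset F -> link x F \subset deletion x F.
Proof.
move=> dF; apply/subsetP => A; rewrite !inE => /andP[xA AF].
by rewrite xA andbT; apply: dF AF _; apply: subsetUr.
Qed.

Lemma big_link (R : Type) (idx : R) (op : Monoid.com_law idx) (V : finType)
    (x : V) (F : {set {set V}}) (h : {set V} -> R) :
  \big[op/idx]_(A in F | x \in A) h A = \big[op/idx]_(A in link x F) h (x |: A).
Proof.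
rewrite (reindex_onto (fun A => x |: A) (fun A => A :\ x)) /=; last first.
  by move=> A /andP[_ xA]; rewrite setD1K.
apply: eq_bigl => A; rewrite !inE eqxx /= andbT andbC.
case: (boolP (x \in A)) => xA /=; last by rewrite setU1K ?eqxx.
apply/negbTE; apply/negP => /andP[/eqP E _]; move: xA.
by rewrite -E !inE eqxx.
Qed.

Lemma big_deletion_link (R : Type) (idx : R) (op : Monoid.com_law idx)
    (V : finType) (x : V) (F : {set {set V}}) (h : {set V} -> R) :
  \big[op/idx]_(A in F) h A =
  op (\big[op/idx]_(A in deletion x F) h A)
     (\big[op/idx]_(A in link x F) h (x |: A)).
Proof.
rewrite -big_link (bigID (fun A : {set V} => x \in A)) /= Monoid.mulmC.
by congr (op _ _); apply: eq_bigl => A; rewrite !inE.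
Qed.

Lemma card_link (V : finType) (x : V) (F : {set {set V}}) :
  #|link x F| = #|[set A in F | x \in A]|.
Proof.
rewrite -!sum1_card -(@big_link _ _ _ _ _ _ (fun=> 1%N)).
by apply: eq_bigl => A; rewrite !inE.
Qed.

Lemma card_deletion_link (V : finType) (x : V) (F : {set {set V}}) :
  #|F| = (#|deletion x F| + #|link x F|)%N.
Proof. by rewrite -!sum1_card (big_deletion_link _ x). Qed.

Lemma sum_deletion_link (V : finType) (x : V) (F : {set {set V}}) (g : nat -> rat)
    (j : nat) :
  \sum_(A in F) g (j + #|A|)%N = \sum_(A in deletion x F) g (j + #|A|)%N
    + \sum_(A in link x F) g (j.+1 + #|A|)%N.
Proof.
rewrite (big_deletion_link _ x); congr (_ + _).
by apply: eq_bigr => A; rewrite !inE => /andP[xA _]; rewrite cardsU1 xA addnS.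
Qed.

(** Induction on [#|L|], splitting at a vertex [v] with [[set v]] in [L]: the link is contained in
    the deletion, so [psi_subadditive] combines the bounds for the two parts. *)
Lemma psi_le_sum (g : nat -> rat) (gA : forall i, g i.+1 <= g i) (V : finType)
    (L : {set {set V}}) (j : nat) (dL : downset L) :
  psi g j #|L| <= \sum_(A in L) g (j + #|A|)%N.
Proof.
have [k] := ubnP #|L|; elim: k L j dL => // k IH L j dL leLk.
have [/existsP[v vL]|] := boolP [exists v, [set v] \in L]; last first.
  rewrite negb_exists => /forallP noL.
  have sL : L \subset [set set0].
    apply/subsetP => A AL; rewrite inE; apply/negPn/negP => /set0Pn[v vA].
    by move: (noL v); rewrite (dL _ _ AL) // sub1set.
  have := sL; rewrite subset1 => /orP[]/eqP ->.
    by rewrite cards1 psiS psi0 add0r big_set1 cards0 addn0.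
  by rewrite cards0 psi0 big_set0.
have dD := deletion_downset (x:=v) dL; have dK := link_downset (x:=v) dL.
have cK := subset_leq_card (link_sub_deletion v dL).
have cL := card_deletion_link v L.
have K0 : (0 < #|link v L|)%N.
  by apply/card_gt0P; exists set0; rewrite !inE setU0.
rewrite (sum_deletion_link v) cL.
apply: le_trans (psi_subadditive gA j cK) _.
by apply: lerD; apply: IH => //; lia.
Qed.

(** * The weights [1 / #|A|] *)

(** The argument is the size of a set in the link of [x], which lacks [x] itself; hence the shift by
    one. *)
Definition recip (s : nat) : rat := s.+1%:R^-1.

Lemma recip_antitone i : recip i.+1 <= recip i.
Proof. by rewrite /recip lef_pV2 ?posrE ?ltr0n // ler_nat. Qed.

(* Integration by parts of [t ^ j * (1 + t) ^ k], whose integral over [0, 1]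
   is [2 ^ k * mu recip k j]. *)
Lemma mu_recip_parts k j :
  j.+1%:R * (2 ^+ k.+1 * mu recip k.+1 j)
    + k.+1%:R * (2 ^+ k * mu recip k j.+1) = 2 ^+ k.+1.
Proof.
elim: k j => [|k IH] j.
  rewrite /= /recip expr1 expr0 -[j.+2]addn1 -[j.+1]addn1 !natrD.
  have ? : 0 <= j%:R :> rat by [].
  field; apply/andP; split; lra.
have := IH j; have := IH j.+1.
rewrite [2 ^+ k.+2]exprS [2 ^+ k.+1]exprS /=.
rewrite -[k.+2]addn1 -[k.+1]addn1 -[j.+2]addn1 -[j.+1]addn1 !natrD.
by lra.
Qed.

(** In terms of integrals, this evaluates the integral of [(1 + t) ^ k] over [0, 1]. *)
Lemma mu_recip0 k : k.+1%:R * (2 ^+ k * mu recip k 0) = 2 ^+ k.+1 - 1.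
Proof.
elim: k => [|k IH]; first by rewrite /= /recip expr1 expr0; lra.
have := mu_recip_parts k 0; move: IH.
rewrite [2 ^+ k.+2]exprS [2 ^+ k.+1]exprS /=.
rewrite -[k.+2]addn1 -[k.+1]addn1 !natrD.
by lra.
Qed.

Lemma mu_recipE k : 2 ^+ k * mu recip k 0 = (2 ^+ k.+1 - 1) / k.+1%:R.
Proof. by rewrite -mu_recip0 [RHS]mulrC mulKf // pnatr_eq0. Qed.

(** By the recursion of [mu], the values at [j = 1] and [j = 2] are first and second differences in
    [k] of those at [j = 0]. *)
Lemma mu_recip1E k :
  2 ^+ k * mu recip k 1 = (2 ^+ k.+2 - 1) / k.+2%:R - (2 ^+ k.+1 - 1) / k.+1%:R.
Proof.
by rewrite -!mu_recipE [2 ^+ k.+1]exprS /=; field.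
Qed.

Lemma mu_recip2E k :
  2 ^+ k * mu recip k 2 = (2 ^+ k.+3 - 1) / k.+3%:R
    - 2 * ((2 ^+ k.+2 - 1) / k.+2%:R) + (2 ^+ k.+1 - 1) / k.+1%:R.
Proof.
have := mu_recip1E k.+1; have := mu_recip1E k.
rewrite ![2 ^+ _.+1]exprS /=.
move: (k.+1%:R^-1 : rat) (k.+2%:R^-1 : rat) (k.+3%:R^-1 : rat) => x y z.
by lra.
Qed.

Lemma mu_recip1_le k : mu recip k 1 - k.+2%:R^-1 <= k%:R / (k.+2%:R * k.+1%:R).
Proof.
have E1 : 1 <= 2 ^+ k :> rat by apply: exprn_ege1.
have k0 : 0 <= k%:R :> rat by [].
have -> : mu recip k 1 = (2 ^+ k)^-1 * (2 ^+ k * mu recip k 1).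
  by rewrite mulKf //; lra.
rewrite mu_recip1E ![2 ^+ _.+1]exprS; move: (2 ^+ k) E1 => E E1.
rewrite -[k.+2]addn2 -[k.+1]addn1 !natrD.
rewrite -subr_ge0.
set x := (X in 0 <= X).
have -> : x = (1 - E^-1) / ((k%:R + 2) * (k%:R + 1)).
  by rewrite /x; field; apply/and3P; split; lra.
apply: divr_ge0; last by apply: mulr_ge0; rewrite addr_ge0.
by rewrite subr_ge0 invf_le1 // (lt_le_trans _ E1).
Qed.

Lemma mu_recip1_le2 k : mu recip k 1 <= 2 / k.+2%:R.
Proof.
have := mu_recip1_le k.
have k0 : 0 <= k%:R :> rat by [].
suff : k%:R / (k.+2%:R * k.+1%:R) <= k.+2%:R^-1 :> rat.
  by move: (k.+2%:R^-1 : rat) (k%:R / _ : rat) => x y; lra.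
rewrite invfM mulrCA ler_piMr // ?invr_ge0 ?ler0n //.
by rewrite ler_pdivrMr ?ltr0n // mul1r ler_nat.
Qed.

(** The gap compares the mean slope of [psi recip 1] on the range up to [2 ^ p.+1] with its slope
    just before that point. *)
Lemma mu_recip_gap p :
  2 ^+ p.+1 * (mu recip p.+1 1 - mu recip p 2) =
  (2 ^+ p.+2 * (p%:R - 1) + p%:R + 5) / (p.+3%:R * p.+2%:R * p.+1%:R).
Proof.
have k0 : 0 <= p%:R :> rat by [].
have -> : 2 ^+ p.+1 * (mu recip p.+1 1 - mu recip p 2) =
  2 ^+ p.+1 * mu recip p.+1 1 - 2 * (2 ^+ p * mu recip p 2) by rewrite exprS; ring.
rewrite mu_recip1E mu_recip2E.
rewrite ![2 ^+ _.+1]exprS.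
rewrite -[p.+3]addn3 -[p.+2]addn2 -[p.+1]addn1 !natrD.
by field; apply/and3P; split; lra.
Qed.

(** The comparison of [2 ^ p] with a polynomial to which the estimates for [d >= 8] are reduced. *)
Lemma cube_vs_pow2 p : (5 <= p)%N -> ((p + 3) * (p + 1) ^ 2 <= 16 * 2 ^ p)%N.
Proof.
move=> /subnK <-; elim: (p - 5)%N => // e IH.
rewrite addSn [(2 ^ _.+1)%N]expnS [leqRHS]mulnCA.
apply: leq_trans _ (leq_mul (leqnn 2) IH).
rewrite -!mulnn; nia.
Qed.

Lemma mu_recip_gap_ge p c : (5 <= p)%N -> (0 < c)%N -> (4 * c <= p.+3)%N ->
  (c%:R - 1) * (mu recip p.+1 1 - p.+3%:R^-1)
    <= 2 ^+ p.+1 / p.+3%:R * (mu recip p.+1 1 - mu recip p 2).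
Proof.
move=> p5 c0 cp.
have P5 : 5 <= p%:R :> rat by rewrite (ler_nat _ 5).
have C1 : 0 <= c%:R - 1 :> rat by rewrite subr_ge0 (ler_nat _ 1).
have Cp : 4 * c%:R <= p%:R + 3 :> rat by rewrite -!natrD -natrM ler_nat addn3.
have := cube_vs_pow2 p5; rewrite -(ler_nat rat) !(natrM, natrX, natrD) => H.
rewrite mulrAC mu_recip_gap.
apply: le_trans (ler_wpM2l C1 (mu_recip1_le p.+1)) _.
rewrite ![2 ^+ _.+1]exprS.
rewrite -[p.+3]addn3 -[p.+2]addn2 -[p.+1]addn1 !natrD.
move: (2 ^+ p) H => E H.
rewrite -subr_ge0.
set x := (X in 0 <= X).
have -> : x = ((2 * (2 * E) * (p%:R - 1) + p%:R + 5)
   - (c%:R - 1) * ((p%:R + 3) * (p%:R + 1) ^+ 2))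
     / ((p%:R + 3) ^+ 2 * (p%:R + 2) * (p%:R + 1)).
  by rewrite /x; field; apply/and3P; split; lra.
apply: divr_ge0; last by rewrite !mulr_ge0 ?sqr_ge0 //; lra.
(* Since [c - 1 <= (p - 1) / 4], the subtracted product is at most [4 * (p - 1) * 2 ^ p], which is
   the leading term of the numerator. *)
have h1 : (c%:R - 1) * ((p%:R + 3) * (p%:R + 1) ^+ 2) <=
  (p%:R - 1) / 4 * (16 * E).
  apply: le_trans (ler_wpM2l C1 H) _.
  apply: ler_wpM2r; last lra.
  have : 0 <= (p%:R + 3) * (p%:R + 1) ^+ 2 :> rat by rewrite !mulr_ge0 ?sqr_ge0 //; lra.
  lra.
lra.
Qed.

Lemma mu_recip_ge0 k j : 0 <= mu recip k j.
Proof.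
elim: k j => [|k IH] j /=; first by rewrite invr_ge0.
by rewrite divr_ge0 ?addr_ge0.
Qed.

Lemma tau_recip_ge0 j i : 0 <= tau recip j i.
Proof. by case: i => [|i]; rewrite ?invr_ge0 // mu_recip_ge0. Qed.

Lemma psi_recip_mono j m n : (m <= n)%N -> psi recip j m <= psi recip j n.
Proof.
move=> /subnKC <-; rewrite psi_add lerDl sumr_ge0 // => i _.
exact: tau_recip_ge0.
Qed.

(** Each of the [e] sets missing from the cube costs the slope [mu recip k 1], at most
    [2 / k.+2]. *)
Lemma near_cube_sum (V : finType) (L : {set {set V}}) (k e : nat) :
  downset L -> (e <= 2 ^ k)%N -> (2 ^ k.+1 - e <= #|L|)%N ->
  (2 ^+ k.+2 - 1 - 2 * e%:R) / k.+2%:R <= \sum_(A in L) recip #|A|.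
Proof.
move=> dL ek leL.
apply: le_trans (psi_le_sum recip_antitone 0 dL).
apply: le_trans (psi_recip_mono 0 leL).
rewrite psi_linear // mu_recipE mulrBl lerD2l lerN2 [2 * _]mulrC -mulrA.
by rewrite ler_wpM2l // mu_recip1_le2.
Qed.

(** The concave [psi recip 1] lies above its chord from 0 to [2 ^ p.+1]. As [b] stays a fraction
    [1 / p.+3] away from the right end, it does so by a definite amount. *)
Lemma psi_recip1_gap p c b : (5 <= p)%N -> (0 < c)%N -> (4 * c <= p.+3)%N ->
  (0 < b)%N -> (p.+3 * b <= p.+2 * 2 ^ p.+1)%N ->
  (c%:R - 1) * (mu recip p.+1 1 - p.+3%:R^-1)
    <= psi recip 1 b - b%:R * mu recip p.+1 1.
Proof.
move=> p5 c0 cp b0 leb.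
have [le_s|lt_s] := leP (mu recip p.+1 1) (tau recip 1 b).
  (* All increments before [b] are at least the slope of the chord, and the first one, [1 / 2],
     already pays for the left side. *)
  have -> : psi recip 1 b = 2^-1 + \sum_(i < b.-1) tau recip 1 (1 + i).
    by rewrite -{1}(prednK b0) -[b.-1.+1]add1n psi_add psiS psi0 add0r.
  have : \sum_(i < b.-1) mu recip p.+1 1 <= \sum_(i < b.-1) tau recip 1 (1 + i).
    apply: ler_sum => i _; apply: le_trans le_s _.
    by apply: (tau_antitone recip_antitone); have := ltn_ord i; lia.
  rewrite sumr_const card_ord -[_ *+ _]mulr_natl.
  have -> : b.-1%:R = b%:R - 1 :> rat by rewrite -{2}(prednK b0) -natr1 addrK.
  have := mu_recip1_le2 p.+1; set s := mu _ _ _.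
  have cp' : 4 * c%:R <= p.+3%:R :> rat by rewrite -natrM ler_nat.
  have c1 : 0 <= c%:R - 1 :> rat by rewrite subr_ge0 (ler_nat _ 1).
  have D0 : 0 < p.+3%:R :> rat by rewrite ltr0n.
  move=> sle; have /(ler_wpM2l c1) : s - p.+3%:R^-1 <= p.+3%:R^-1.
    by move: sle; move: (p.+3%:R^-1 : rat) => x; lra.
  have : (c%:R - 1) * p.+3%:R^-1 <= 4^-1 - p.+3%:R^-1 :> rat.
    rewrite -ler_pdivlMr ?invr_gt0 // invrK mulrBl mulVf ?lt0r_neq0 //; lra.
  have : p.+3%:R^-1 <= 8^-1 :> rat.
    by rewrite lef_pV2 ?posrE // (ler_nat _ 8) !ltnS.
  move: (p.+3%:R^-1 : rat) sle => x; lra.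
(* From [b] on the increments are below the slope of the chord, so replacing [b] by [y] only lowers
   the right side; at [y >= 2 ^ p] the function is linear. *)
pose y := maxn b (2 ^ p); pose e := (2 ^ p.+1 - y)%N.
have E2 : (2 ^ p.+1 = 2 * 2 ^ p)%N by rewrite expnS.
have eb : (p.+3 * e >= 2 ^ p.+1)%N.
  rewrite /e /y; case: (leqP b (2 ^ p)) => H; move: leb; rewrite E2;
  move: (2 ^ p)%N H => E H; nia.
have ey : (y = 2 ^ p.+1 - e)%N.
  by rewrite /e subKn // /y geq_max E2; move: leb; rewrite E2; nia.
have le_by : (b <= y)%N by rewrite leq_maxl.
have : psi recip 1 y <= psi recip 1 b + (y%:R - b%:R) * mu recip p.+1 1.
  rewrite -{1}(subnKC le_by) psi_add lerD2l -natrB // mulr_natl.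
  rewrite -[(y - b)%N in leRHS]card_ord -sumr_const; apply: ler_sum => i _.
  apply: le_trans (ltW lt_s); apply: (tau_antitone recip_antitone); lia.
have ep : (e <= 2 ^ p)%N by rewrite /e /y E2; lia.
have yE : y%:R = 2 ^+ p.+1 - e%:R :> rat.
  by rewrite ey natrB ?natrX // E2 (leq_trans ep) // leq_pmull.
rewrite yE ey psi_linear //.
have g0 : 0 <= mu recip p.+1 1 - mu recip p 2.
  rewrite -(pmulr_rge0 _ (exprn_gt0 p.+1 (ltr0n rat 2))) mu_recip_gap.
  apply: divr_ge0; last by rewrite !mulr_ge0.
  rewrite -addrA; apply: addr_ge0; last by rewrite addr_ge0.
  by apply: mulr_ge0; rewrite ?exprn_ge0 // subr_ge0 (ler_nat _ 1); lia.
have /(ler_wpM2r g0) : 2 ^+ p.+1 / p.+3%:R <= e%:R :> rat.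
  by rewrite ler_pdivrMr // -natrX -natrM ler_nat mulnC.
move=> le_e le_psi; apply: le_trans (le_trans (mu_recip_gap_ge p5 c0 cp) le_e) _.
lra.
Qed.

(** * Vertices of small degree *)

Lemma sum_card_link (V : finType) (F : {set {set V}}) :
  (\sum_(v : V) #|link v F| = \sum_(A in F) #|A|)%N.
Proof.
rewrite (eq_bigr (fun v : V => \sum_(A in F | v \in A) 1)%N) => [|v _]; last first.
  by rewrite card_link -sum1_card; apply: eq_bigl => A; rewrite !inE.
rewrite (exchange_big_dep (fun A => A \in F)) /=; last by move=> v A _ /andP[].
by apply: eq_bigr => A AF; rewrite -sum1_card; apply: eq_bigl => v; rewrite AF.
Qed.

Lemma mu_opp k j : mu (fun i => - i%:R) k j = - (j%:R + k%:R / 2).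
Proof.
elim: k j => [|k IH] j /=; first by rewrite mul0r addr0.
by rewrite !IH -[j.+1]addn1 -[k.+1]addn1 !natrD; field.
Qed.

(** An upper bound, from [psi_le_sum] for the decreasing function [- i]: the total size is at most
    that of the cube. *)
Lemma downset_sum_card (V : finType) (L : {set {set V}}) (k : nat) :
  downset L -> (#|L| <= 2 ^ k.+1)%N -> (\sum_(A in L) #|A| <= k.+1 * 2 ^ k)%N.
Proof.
move=> dL leL; pose g i : rat := - i%:R.
have gA i : g i.+1 <= g i by rewrite lerN2 ler_nat.
have : psi g 0 #|L| <= - \sum_(A in L) #|A|%:R.
  by rewrite -sumrN; apply: psi_le_sum gA _ _ 0%N dL.
have : psi g 0 (2 ^ k.+1) <= psi g 0 #|L|.
  rewrite -(subnKC leL) psi_add gerDl; apply: sumr_le0 => i _.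
  by apply: le_trans (tau_antitone gA 0 (leq0n _)) _; rewrite /= /g oppr0.
rewrite psi_pow2 mu_opp => h1 h2; have := le_trans h1 h2.
rewrite -(ler_nat rat) natr_sum natrM natrX exprS add0r.
lra.
Qed.

Definition vertices (V : finType) (L : {set {set V}}) : {set V} :=
  [set v | [set v] \in L].

(** Averaging: the degrees add up to the total size of the members, at most [k.+1 * 2 ^ k]. *)
Lemma light_vertex (V : finType) (L : {set {set V}}) (k : nat) :
  downset L -> (#|L| <= 2 ^ k.+1)%N -> (k.+2 <= #|vertices L|)%N ->
  exists2 v, v \in vertices L & (k.+2 * #|link v L| <= k.+1 * 2 ^ k)%N.
Proof.
move=> dL leL leV; apply/exists_inP; apply: contraT => /exists_inPn H.
have := downset_sum_card dL leL; rewrite -sum_card_link.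
have : (\sum_(v in vertices L) (k.+1 * 2 ^ k).+1 <=
        k.+2 * \sum_(v : V) #|link v L|)%N.
  rewrite big_distrr /= [leqRHS](bigID (mem (vertices L))) /=.
  apply: leq_trans (leq_addr _ _); apply: leq_sum => v /H.
  by rewrite -ltnNge.
rewrite sum_nat_const; move: #|vertices L| (k.+1 * _)%N (\sum_v _)%N leV => W X Y; nia.
Qed.

(* Splitting at a vertex [v] of small degree [b] leaves [a] sets without [v]
   and [b] with [v]; since [a > b] by a wide margin, [psi_subadditive] is far
   from tight, which pays for the [c - 1] sets missing from a full cube. *)
Lemma wide_downset_sum (V : finType) (L : {set {set V}}) (p c : nat) :
  (5 <= p)%N -> (0 < c)%N -> (4 * c <= p.+3)%N -> downset L ->
  (2 ^ p.+2 - c.-1 <= #|L|)%N -> (p.+3 <= #|vertices L|)%N ->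
  (2 ^+ p.+3 - c%:R) / p.+3%:R <= \sum_(A in L) recip #|A|.
Proof.
move=> p5 c0 cp dL leL leV.
have D0 : 0 < p.+3%:R :> rat by rewrite ltr0n.
have c1 : 1 <= c%:R :> rat by rewrite (ler_nat _ 1).
case: (leqP (2 ^ p.+2) #|L|) => [big|small].
  apply: le_trans (near_cube_sum (e:=0) (k:=p.+1) dL _ _); rewrite ?subn0 //.
  by rewrite ler_pM2r ?invr_gt0 // mulr0; lra.
have [v vL leb] := light_vertex dL (ltnW small) leV.
set b := #|link v L| in leb.
have b0 : (0 < b)%N.
  by apply/card_gt0P; exists set0; move: vL; rewrite !inE setU0.
have cL := card_deletion_link v L; rewrite -/b in cL.
have cpow : (p.+3 * c.-1 <= 2 ^ p.+1)%N.
  have := cube_vs_pow2 p5; rewrite -mulnn [(2 ^ p.+1)%N]expnS.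
  by move: (2 ^ p)%N => E; nia.
have E2 : (2 ^ p.+2 = 2 * 2 ^ p.+1)%N by rewrite expnS.
(* The deletion falls short of the cube by [e]; small [b] and [c] keep [e] within the linear range
   of [psi]. *)
pose e := (2 ^ p.+2 - #|deletion v L|)%N.
have ep : (e <= 2 ^ p.+1)%N.
  by rewrite /e; move: E2 leb leL cpow; move: (2 ^ p.+1)%N => E; nia.
have ea : #|deletion v L| = (2 ^ p.+2 - e)%N by rewrite /e; lia.
have eb : (e <= b + c.-1)%N by rewrite /e; lia.
have -> := sum_deletion_link v L recip 0 : \sum_(A in L) recip #|A| = _.
have := psi_le_sum recip_antitone 0 (deletion_downset (x:=v) dL).
rewrite ea psi_linear // mu_recipE.
have := psi_le_sum recip_antitone 1 (link_downset (x:=v) dL).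
rewrite -/b.
(* Against the loss of [e <= b + c.-1] times [mu recip p.+1 1], the gain from the link leaves a net
   loss of at most [(c - 1) / p.+3]. *)
have := psi_recip1_gap p5 c0 cp b0 leb.
have /(ler_wpM2r (mu_recip_ge0 p.+1 1)) : e%:R <= b%:R + (c%:R - 1) :> rat.
  by rewrite -(ler_nat rat) natrD in eb; rewrite -{1}(prednK c0) -natr1 addrK.
rewrite mulrBl; move: (p.+3%:R^-1 : rat) => x.
lra.
Qed.

Definition weight (V : finType) (F : {set {set V}}) (x : V) : rat :=
  \sum_(A in F | x \in A) #|A|%:R^-1.

Lemma weight_link (V : finType) (F : {set {set V}}) (x : V) :
  weight F x = \sum_(A in link x F) recip #|A|.
Proof.
rewrite /weight big_link; apply: eq_bigr => A; rewrite !inE => /andP[xA _].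
by rewrite cardsU1 xA.
Qed.

(** Every nonempty member hands out a total weight of 1. *)
Lemma sum_weight (V : finType) (F : {set {set V}}) :
  set0 \in F -> \sum_x weight F x = #|F|%:R - 1.
Proof.
move=> F0; rewrite /weight (exchange_big_dep (fun A => A \in F)) /=; last first.
  by move=> v A _ /andP[].
have -> : #|F|%:R - 1 = \sum_(A in F :\ set0) 1 :> rat.
  by rewrite sumr_const (cardsD1 set0 F) F0 natrD addrC addKr.
rewrite (big_setD1 set0) //= big1 ?add0r => [|v]; last by rewrite F0 inE.
apply: eq_bigr => A; rewrite !inE => /andP[A0 AF].
rewrite (eq_bigl (mem A)) => [|v]; last by rewrite AF.
by rewrite sumr_const -[_ *+ _]mulr_natl mulfV // pnatr_eq0 cards_eq0.
Qed.

Lemma downset0 (V : finType) (F : {set {set V}}) (A : {set V}) :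
  downset F -> A \in F -> set0 \in F.
Proof. by move=> dF AF; apply: dF AF _; apply: sub0set. Qed.

Lemma card_subsets_at (V : finType) (B : {set V}) (x : V) :
  x \in B -> #|link x (powerset B)| = (2 ^ #|B|.-1)%N.
Proof.
move=> xB; rewrite (cardsD1 x B) xB -card_powerset; apply: eq_card => A.
by rewrite !inE subUset sub1set xB subsetD1 andbC.
Qed.

(** * Blocks *)

(** For a center [x] this is its block. *)
Definition closed_nbhd (V : finType) (F : {set {set V}}) (x : V) : {set V} :=
  x |: vertices (link x F).

Lemma closed_nbhdP (V : finType) (F : {set {set V}}) (x v : V) :
  [set x] \in F -> (v \in closed_nbhd F x) = ([set x; v] \in F).
Proof.
move=> xF; rewrite !inE; by have [->|//] := eqVneq v x; rewrite setUid xF.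
Qed.

Lemma sub_closed_nbhd (V : finType) (F : {set {set V}}) (x : V) (A : {set V}) :
  downset F -> A \in F -> x \in A -> A \subset closed_nbhd F x.
Proof.
move=> dF AF xA; apply/subsetP => v vA; rewrite closed_nbhdP.
  by apply: dF AF _; rewrite subUset !sub1set xA vA.
by apply: dF AF _; rewrite sub1set.
Qed.

Definition missing (V : finType) (F : {set {set V}}) (B : {set V}) :
  {set {set V}} := powerset B :\: F.

Lemma missing_up (V : finType) (F : {set {set V}}) (B A C : {set V}) :
  downset F -> A \in missing F B -> A \subset C -> C \subset B ->
  C \in missing F B.
Proof.
move=> dF; rewrite !inE => /andP[AF _] AC CB; rewrite CB andbT.
by apply: contra AF => CF; apply: dF CF AC.
Qed.

Lemma card_link_missing (V : finType) (F : {set {set V}}) (B : {set V}) (x : V) :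
  x \in B ->
  (#|link x (missing F B)| + #|link x (F :&: powerset B)| = 2 ^ #|B|.-1)%N.
Proof.
move=> xB; rewrite -(card_subsets_at xB) addnC -[RHS](cardsID (link x F)).
congr (_ + _)%N; apply: eq_card => A; rewrite !inE.
  by case: (x \in A); case: (x |: A \in F); rewrite ?andbF ?andbT.
by case: (x \in A); case: (x |: A \in F); rewrite ?andbF ?andbT.
Qed.

Lemma card_missing (V : finType) (F : {set {set V}}) (B : {set V}) :
  (#|missing F B| + #|F :&: powerset B| = 2 ^ #|B|)%N.
Proof. by rewrite -card_powerset addnC setIC cardsID. Qed.

(** Missing sets are closed upwards inside [B], so adding [x] to one that avoids [x] gives another
    one. *)
Lemma card_missing_le (V : finType) (F : {set {set V}}) (B : {set V}) (x : V) :
  downset F -> x \in B ->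
  (#|missing F B| <= 2 * #|link x (missing F B)|)%N.
Proof.
move=> dF xB; rewrite (card_deletion_link x) mul2n -addnn leq_add2r.
apply/subset_leq_card/subsetP => A; rewrite inE => /andP[mA xA].
have AB : A \subset B by move: mA; rewrite !inE => /andP[].
rewrite inE xA; apply: missing_up mA _ _ => //; first exact: subsetUr.
by rewrite subUset sub1set xB.
Qed.

(* From here on [d = p + 3].  By [card_nbhd_center], under the degree condition
   the link of a center has exactly [d - 1] vertices, so that it misses at most
   [c - 1] subsets of these. *)
Definition center (V : finType) (F : {set {set V}}) (p : nat) (x : V) : bool :=
  (#|vertices (link x F)| < p.+3)%N.

(** A link with fewer than [p.+2] vertices has at most [2 ^ p.+1] members, below the degree
    bound. *)
Lemma card_nbhd_center (V : finType) (F : {set {set V}}) (p c : nat) (x : V) :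
  (0 < c)%N -> (4 * c <= p.+3)%N -> downset F ->
  (2 ^ p.+2 - c.-1 <= #|link x F|)%N -> center F p x ->
  #|closed_nbhd F x| = p.+3.
Proof.
move=> c0 cp dF degx cx; rewrite cardsU1 !inE eqxx add1n; congr _.+1.
have dL := link_downset (x:=x) dF.
have : (#|link x F| <= 2 ^ #|vertices (link x F)|)%N.
  rewrite -card_powerset; apply/subset_leq_card/subsetP => A AL.
  rewrite inE; apply/subsetP => v vA; rewrite inE.
  by apply: dL AL _; rewrite sub1set.
apply: contraTeq => neq; rewrite -ltnNge; apply: leq_trans degx.
apply: (@leq_ltn_trans (2 ^ p.+1)).
  by rewrite leq_exp2l //; move: cx neq; rewrite /center; lia.
have := ltn_expl p (isT : 1 < 2)%N.
by rewrite !expnS; move: (2 ^ p)%N => E; lia.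
Qed.

Lemma center_in_nbhd (V : finType) (F : {set {set V}}) (x : V) :
  x \in closed_nbhd F x.
Proof. exact: setU11. Qed.

Lemma link_missing_center (V : finType) (F : {set {set V}}) (p c : nat) (x : V) :
  (0 < c)%N -> (4 * c <= p.+3)%N -> downset F ->
  (2 ^ p.+2 - c.-1 <= #|link x F|)%N -> center F p x ->
  (#|link x (missing F (closed_nbhd F x))| <= c.-1)%N.
Proof.
move=> c0 cp dF degx cx.
have := card_link_missing F (center_in_nbhd F x).
rewrite (card_nbhd_center c0 cp dF degx cx) /=.
suff -> : link x (F :&: powerset (closed_nbhd F x)) = link x F.
  by move: degx; move: (2 ^ p.+2)%N #|link x F| #|link x _| => E a b; lia.
apply/setP => A; rewrite inE [RHS]inE; case: (x \in A) => //=.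
rewrite inE; case AF: (x |: A \in F) => //=.
by rewrite inE sub_closed_nbhd // setU11.
Qed.

(** If [[set u; v]] were missing, so would be all subsets of the block that contain [x], [u] and
    [v]; there are at least [2 ^ p > c - 1] of them. *)
Lemma center_pair (V : finType) (F : {set {set V}}) (p c : nat) (x u v : V) :
  (0 < c)%N -> (4 * c <= p.+3)%N -> downset F ->
  (2 ^ p.+2 - c.-1 <= #|link x F|)%N -> center F p x ->
  u \in closed_nbhd F x -> v \in closed_nbhd F x -> [set u; v] \in F.
Proof.
move=> c0 cp dF degx cx; set B := closed_nbhd F x => uB vB.
apply/negPn/negP => uvF.
have xB : x \in B by apply: center_in_nbhd.
have := link_missing_center c0 cp dF degx cx; rewrite -/B card_link.
apply/negP; rewrite -ltnNge.
pose W := x |: [set u; v].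
have WB : W \subset B by rewrite !subUset !sub1set xB uB vB.
have cW : (#|W| <= 3)%N.
  by rewrite cardsU1 cards2; case: (_ \notin _); case: (_ != _).
have inj : {in powerset (B :\: W) &, injective (fun A => A :|: W)}.
  move=> A A'; rewrite !inE !subsetD => /andP[_ dA] /andP[_ dA'] E.
  have K (C : {set V}) : [disjoint C & W] -> (C :|: W) :\: W = C.
    by move=> dC; rewrite setDUl setDv setU0; apply/setDidPl.
  by rewrite -(K _ dA) -(K _ dA') E.
apply: (@leq_trans #|[set A :|: W | A in powerset (B :\: W)]|).
  rewrite (card_in_imset inj) card_powerset cardsD (setIidPr WB).
  have cB : #|B| = p.+3 by apply: card_nbhd_center c0 cp dF degx cx.
  apply: (@leq_trans (2 ^ p)); last by rewrite leq_exp2l // cB; lia.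
  by have := ltn_expl p (isT : 1 < 2)%N; lia.
apply/subset_leq_card/subsetP => C /imsetP[A]; rewrite inE subsetD => /andP[AB _] ->.
rewrite inE; apply/andP; split; last by rewrite !inE eqxx orbT.
apply/setDP; split; first by rewrite inE subUset AB WB.
by apply: contra uvF => H; apply: dF H _; rewrite subsetU // subsetUr orbT.
Qed.

(** By [center_pair], all vertices of the block of [y] are neighbours of [x] or [x] itself, and both
    blocks have [p.+3] vertices. *)
Lemma center_nbhd_eq (V : finType) (F : {set {set V}}) (p c : nat) (x y : V) :
  (0 < c)%N -> (4 * c <= p.+3)%N -> downset F ->
  (forall z, 2 ^ p.+2 - c.-1 <= #|link z F|)%N -> center F p x -> center F p y ->
  x \in closed_nbhd F y -> closed_nbhd F y = closed_nbhd F x.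
Proof.
move=> c0 cp dF deg cx cy xy; apply/eqP; rewrite eqEcard.
rewrite !(@card_nbhd_center _ _ p c) // leqnn andbT.
apply/subsetP => v vy.
have := center_pair c0 cp dF (deg y) cy xy vy => xv.
by rewrite closed_nbhdP //; apply: dF xv _; rewrite subsetUl.
Qed.

Lemma weight_sub (V : finType) (F G : {set {set V}}) (y : V) :
  G \subset F -> weight G y <= weight F y.
Proof.
move=> sGF; rewrite /weight big_mkcondr [leRHS]big_mkcondr /=.
rewrite [leRHS](big_setID G) /= (setIidPr sGF).
by rewrite lerDl sumr_ge0 // => A _; case: ifP => // _; rewrite invr_ge0.
Qed.

Lemma restrict_downset (V : finType) (F : {set {set V}}) (B : {set V}) :
  downset F -> downset (F :&: powerset B).
Proof.
move=> dF A C; rewrite !inE => /andP[AF AB] CA.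
by rewrite (dF _ _ AF CA) (subset_trans CA AB).
Qed.

Lemma weight_outer_pair (V : finType) (F : {set {set V}}) (B : {set V}) (y z : V) :
  [set y; z] \in F -> y \in B -> z \notin B ->
  weight (F :&: powerset B) y + 2^-1 <= weight F y.
Proof.
move=> yzF yB zB; have yz : y != z by apply: contraNneq zB => <-.
have -> : weight F y = weight (F :&: powerset B) y
    + \sum_(A in F :\: powerset B | y \in A) #|A|%:R^-1.
  rewrite /weight big_mkcondr (big_setID (powerset B)) /=.
  by rewrite -!big_mkcondr.
rewrite lerD2l (bigD1 [set y; z]) /=; last first.
  by rewrite !inE yzF eqxx !andbT subUset !sub1set (negbTE zB) andbF.
by rewrite cards2 yz lerDl sumr_ge0 // => A _; rewrite invr_ge0.
Qed.

(** With [N] missing sets, the members inside the block contribute [2 ^ p.+3 - N - 1], enough if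
    [N < c]. Otherwise [N <= 2 * (c - 1)], and all but [c - 1] vertices of the block gain [1 / 2]
    from a pair leaving it. *)
Lemma center_nbhd_weight (V : finType) (F : {set {set V}}) (p c : nat) (x : V) :
  (0 < c)%N -> (4 * c <= p.+3)%N -> downset F ->
  (forall z, 2 ^ p.+2 - c.-1 <= #|link z F|)%N -> center F p x ->
  2 ^+ p.+3 - c%:R <= \sum_(y in closed_nbhd F x) weight F y.
Proof.
move=> c0 cp dF deg cx; set B := closed_nbhd F x; set G := F :&: powerset B.
have cB : #|B| = p.+3 := card_nbhd_center c0 cp dF (deg x) cx.
have xB : x \in B := center_in_nbhd F x.
have cL := link_missing_center c0 cp dF (deg x) cx; rewrite -/B in cL.
have cM := card_missing_le dF xB.
have cG := card_missing F B; rewrite -/G cB in cG.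
have G0 : set0 \in G.
  rewrite inE powersetE sub0set andbT; apply: (downset0 dF (A := [set x; x])).
  exact: (center_pair c0 cp dF (deg x) cx xB xB).
clearbody B.
have sumG : \sum_(y in B) weight G y = #|G|%:R - 1.
  rewrite -sum_weight // [RHS](bigID (mem B)) /= [X in _ + X]big1 ?addr0 // => y yB.
  rewrite /weight big1 // => A; rewrite !inE => /andP[/andP[_ AB] yA].
  by rewrite (subsetP AB) in yB.
have GE : #|G|%:R = 2 ^+ p.+3 - #|missing F B|%:R :> rat.
  by rewrite -natrX -cG natrD addrC addKr.
have sGF : G \subset F by apply: subsetIl.
case: (leqP c #|missing F B|) => [cN|Nc]; last first.
  apply: le_trans (_ : \sum_(y in B) weight G y <= _); last first.
    by apply: ler_sum => y _; apply: weight_sub.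
  rewrite sumG GE; have : #|missing F B|%:R + 1 <= c%:R :> rat by rewrite natr1 ler_nat.
  lra.
pose U := [set y in B | B :\ y \in F].
have BN : B \in missing F B.
  have /card_gt0P[A mA] : (0 < #|missing F B|)%N by apply: leq_trans cN.
  have AB : A \subset B by move: mA; rewrite !inE => /andP[].
  exact: missing_up mA AB _.
(* [B] and the sets [B :\ y], with [y] outside [U] and distinct from [x], are different missing sets
   through [x], of which there are at most [c - 1]. *)
have cU : (p.+3 - c.-1 <= #|U|)%N.
  have inj : {in B &, injective (fun y => B :\ y)}.
    move=> y z yB zB /setP /(_ y); rewrite !inE eqxx /= yB andbT.
    by move/esym/negbFE/eqP.
  have sub : [set B :\ y | y in (B :\: U) :\ x] \subset
      [set A in missing F B | x \in A] :\ B.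
    apply/subsetP => A /imsetP[y]; rewrite !inE => /and3P[yx yU yB] ->.
    rewrite yB /= in yU.
    rewrite yU subD1set in_setD1 xB [x == y]eq_sym yx !andbT.
    by apply/eqP => /setP /(_ y); rewrite in_setD1 eqxx yB.
  have := subset_leq_card sub; rewrite card_in_imset; last first.
    by move=> y z; rewrite !inE => /and3P[_ _ yB] /and3P[_ _ zB]; apply: inj.
  have := cardsD1 B [set A in missing F B | x \in A].
  rewrite inE BN xB /= -card_link => E1 E2.
  have := cardsD1 x (B :\: U); have := cardsID U B.
  have -> : B :&: U = U by apply/setIidPr/subsetP => y; rewrite inE => /andP[].
  rewrite cB; move: E1 E2 cL.
  move: #|_ :\ B| #|(B :\: U) :\ x| #|B :\: U| #|U| #|link x _| => a b e u l.
  by case: (x \in _) => /=; lia.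
(* A missing set avoiding [y] would lie below [B :\ y], so all of them, at least [c], contain [y].
   If no member through [y] left [B], the degree of [y] would be too small. *)
have outer y : y \in U -> weight G y + 2^-1 <= weight F y.
  rewrite inE => /andP[yB yF].
  have /subsetPn[A] : ~~ ([set A in F | y \in A] \subset powerset B).
    apply/negP => /subsetP sub; have := card_link_missing F yB.
    rewrite cB -/G /=.
    have -> : link y G = link y F.
      apply/setP => A; rewrite inE [RHS]inE; case: (y \in A) => //=.
      rewrite inE; case AF: (y |: A \in F) => //=.
      by apply: sub; rewrite inE AF setU11.
    suff mE : deletion y (missing F B) = set0.
      have := card_deletion_link y (missing F B); rewrite mE cards0 add0n => <-.
      have := deg y; have := ltn_expl p (isT : 1 < 2)%N.
      move: cN cL cM; rewrite !expnS.
      by move: (2 ^ p)%N #|missing F B| #|link y F| #|link x _| => E N l m; lia.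
    apply/setP => A; rewrite in_set0; apply/negP; rewrite inE => /andP[mA yA].
    move: mA; rewrite !inE => /andP[/negP AF AB]; apply: AF; apply: dF yF _.
    by rewrite subsetD1 AB.
  rewrite inE => /andP[AF yA]; rewrite inE => /subsetPn[z zA zB].
  apply: weight_outer_pair yB zB; apply: dF AF _.
  by rewrite subUset !sub1set yA.
have sUB : U \subset B by apply/subsetP => y; rewrite inE => /andP[].
have : \sum_(y in B) weight G y + #|U|%:R / 2 <= \sum_(y in B) weight F y.
  rewrite (big_setID U) [leRHS](big_setID U) /= (setIidPr sUB) addrAC.
  apply: lerD; last by apply: ler_sum => y _; apply: weight_sub.
  by rewrite mulr_natl -sumr_const -big_split; apply: ler_sum => y /outer.
rewrite sumG GE.
have : #|missing F B|%:R <= 2 * (c%:R - 1) :> rat.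
  rewrite -[1](mulr1n 1) -natrB // -natrM ler_nat subn1.
  by apply: leq_trans cM _; rewrite leq_mul2l.
have : p.+3%:R <= #|U|%:R + (c%:R - 1) :> rat.
  by rewrite -[X in _ - X](mulr1n 1) -natrB // -natrD ler_nat subn1; lia.
have : 4 * c%:R <= p.+3%:R :> rat by rewrite -natrM ler_nat.
have : 0 <= c%:R :> rat by [].
lra.
Qed.

(** [near_cube_sum] with [e = c - 1]: the deficit of a single vertex is at most [(c - 1) / d]. *)
Lemma weight_ge (V : finType) (F : {set {set V}}) (k c : nat) (x : V) :
  (0 < c)%N -> (4 * c <= k.+2)%N -> downset F ->
  (2 ^ k.+1 - c.-1 <= #|link x F|)%N ->
  (2 ^+ k.+2 - c%:R) / k.+2%:R - (c%:R - 1) / k.+2%:R <= weight F x.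
Proof.
move=> c0 ck dF deg; rewrite weight_link.
apply: le_trans (near_cube_sum (link_downset (x:=x) dF) _ deg); last first.
  by have := ltn_expl k (isT : 1 < 2)%N; lia.
rewrite -mulrBl ler_pM2r ?invr_gt0 ?ltr0n //.
have -> : c.-1%:R = c%:R - 1 :> rat by rewrite -{2}(prednK c0) -natr1 addrK.
lra.
Qed.

Lemma weight_not_center (V : finType) (F : {set {set V}}) (p c : nat) (x : V) :
  (5 <= p)%N -> (0 < c)%N -> (4 * c <= p.+3)%N -> downset F ->
  (2 ^ p.+2 - c.-1 <= #|link x F|)%N -> ~~ center F p x ->
  (2 ^+ p.+3 - c%:R) / p.+3%:R <= weight F x.
Proof.
move=> p5 c0 cp dF deg; rewrite -leqNgt weight_link => cx.
exact: wide_downset_sum (link_downset (x:=x) dF) deg cx.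
Qed.

(** A set of blocks, so that a block with several centers counts once. *)
Definition center_nbhds (V : finType) (F : {set {set V}}) (p : nat) :
  {set {set V}} := [set closed_nbhd F x | x : V & center F p x].

(** Members of the link of [x] avoiding [y] live on [p.+1] vertices, so there are at most [2 ^ p.+1]
    of them. *)
Lemma card_pair_link (V : finType) (F : {set {set V}}) (p c : nat) (x y : V) :
  (0 < c)%N -> (4 * c <= p.+3)%N -> downset F ->
  (2 ^ p.+2 - c.-1 <= #|link x F|)%N -> center F p x ->
  y \in closed_nbhd F x -> y != x ->
  (2 ^ p.+1 - c.-1 <= #|[set A in F | (y \in A) && (x \in A)]|)%N.
Proof.
move=> c0 cp dF deg cx yB yx.
have cB := card_nbhd_center c0 cp dF deg cx.
have -> : #|[set A in F | (y \in A) && (x \in A)]| = #|link y (link x F)|.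
  rewrite -!sum1_card -(@big_link _ _ _ _ _ _ (fun=> 1%N)).
  rewrite [RHS](eq_bigl (fun A => (A \in link x F) && (y \in x |: A))); last first.
    by move=> A; rewrite in_setU1 (negbTE yx).
  rewrite [RHS]big_mkcondr.
  rewrite -(@big_link _ _ _ _ x F (fun A => if y \in A then 1%N else 0%N)).
  rewrite -big_mkcondr; apply: eq_bigl => A; rewrite inE -andbA.
  by congr andb; rewrite andbC.
have := card_deletion_link y (link x F).
have : (#|deletion y (link x F)| <= 2 ^ p.+1)%N.
  have -> : p.+1 = #|(closed_nbhd F x :\ x) :\ y|.
    have := cardsD1 x (closed_nbhd F x); have := cardsD1 y (closed_nbhd F x :\ x).
    by rewrite cB setU11 in_setD1 yx yB; lia.
  rewrite -card_powerset; apply/subset_leq_card/subsetP => A.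
  rewrite inE => /andP[]; rewrite inE => /andP[xA AF] yA.
  rewrite inE !subsetD1 xA yA !andbT; apply: subset_trans (subsetUr [set x] A) _.
  by apply: sub_closed_nbhd => //; rewrite setU11.
move: deg; rewrite [(2 ^ p.+2)%N]expnS.
by move: (2 ^ p.+1)%N #|link x F| #|deletion _ _| #|link _ _| => E a b l; lia.
Qed.

(* A vertex shared by several blocks lies in one near-cube and, for each other
   block, in about [2 ^ (d - 2)] further sets through the center of that block;
   these families are disjoint because no center lies in another block. *)
Lemma weight_overlap (V : finType) (F : {set {set V}}) (p c : nat) (y : V) :
  (5 <= p)%N -> (0 < c)%N -> (4 * c <= p.+3)%N -> downset F ->
  (forall z, 2 ^ p.+2 - c.-1 <= #|link z F|)%N ->
  (1 < #|[set B in center_nbhds F p | y \in B]|)%N ->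
  (2 ^+ p.+3 - c%:R) / p.+3%:R
    + #|[set B in center_nbhds F p | y \in B]|%:R * (c%:R - 1) <= weight F y.
Proof.
move=> p5 c0 cp dF deg; set S := [set B in _ | _] => S1.
have [ctr ctrP] : exists ctr : {set V} -> V, forall B, B \in S ->
    center F p (ctr B) /\ closed_nbhd F (ctr B) = B.
  (* The default [y] is never reached for [B] in [S], which is the block of some center. *)
  exists (fun B => odflt y [pick x | center F p x && (closed_nbhd F x == B)]).
  move=> B; rewrite inE => /andP[/imsetP[x]]; rewrite inE => cx -> _.
  by case: pickP => [z /andP[cz /eqP]|/(_ x)] //; rewrite cx eqxx.
have yS B : B \in S -> y \in B by rewrite inE => /andP[].
have cS B : B \in S -> #|B| = p.+3.
  by case/ctrP => cx <-; apply: card_nbhd_center c0 cp dF (deg _) cx.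
have ctrS B B' : B \in S -> B' \in S -> ctr B \in B' -> B' = B.
  move=> /ctrP[cx EB] /ctrP[cx' EB'].
  rewrite -{1}EB' -{2}EB -{2}EB'; exact: (center_nbhd_eq c0 cp dF deg).
have /card_gt0P[B1 B1S] : (0 < #|S|)%N by apply: ltnW.
have split_weight :
    weight (F :&: powerset B1) y
      + \sum_(B in S :\ B1) \sum_(A in F | (y \in A) && (ctr B \in A)) #|A|%:R^-1
    <= weight F y.
  have -> : weight (F :&: powerset B1) y =
      \sum_(A in F | y \in A) (if A \subset B1 then #|A|%:R^-1 else 0).
    by rewrite -big_mkcondr; apply: eq_bigl => A; rewrite !inE andbAC.
  have -> : \sum_(B in S :\ B1)
      \sum_(A in F | (y \in A) && (ctr B \in A)) (#|A|%:R^-1 : rat)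
    = \sum_(A in F | y \in A) \sum_(B in S :\ B1 | ctr B \in A) #|A|%:R^-1.
    rewrite (exchange_big_dep (fun A => (A \in F) && (y \in A))) /=; last first.
      by move=> B A _ /and3P[-> ->].
    apply: eq_bigr => A /andP[AF yA]; apply: eq_bigl => B.
    by rewrite AF yA.
  rewrite -big_split; apply: ler_sum => A /andP[AF yA] /=.
  (* A member inside [B1] contains no center of another block. Any other member contains at most one
     of the chosen centers, since it lies in the block of that center; so no member is counted
     twice. *)
  case: ifP => AB1.
    rewrite big_pred0 ?addr0 // => B; apply/negP => /andP[/setD1P[BB1 BS] cA].
    by move: BB1; rewrite (ctrS B B1) ?eqxx // (subsetP AB1).
  rewrite add0r; case: (pickP (fun B => (B \in S :\ B1) && (ctr B \in A))) => [B|no].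
    move=> /andP[BS cA]; rewrite (bigD1 B) /= ?BS // big1 ?addr0 //.
    move=> B' /andP[/andP[B'S cA'] B'B].
    have [/setD1P[_ bS] /setD1P[_ b'S]] := (BS, B'S).
    move: B'B; rewrite -(ctrS B' B) ?eqxx //.
    have [_ <-] := ctrP _ bS.
    by apply: (subsetP (sub_closed_nbhd dF AF cA)).
  by rewrite big_pred0 ?invr_ge0.
apply: le_trans split_weight.
have leB1 : (2 ^+ p.+3 - 1 - 2 * (2 * c.-1)%:R) / p.+3%:R
    <= weight (F :&: powerset B1) y.
  rewrite weight_link.
  have dG : downset (link y (F :&: powerset B1)).
    exact: link_downset (restrict_downset dF).
  apply: (near_cube_sum (k := p.+1) dG).
    have := ltn_expl p (isT : 1 < 2)%N; rewrite expnS.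
    by move: (2 ^ p)%N => E; lia.
  have := card_link_missing F (yS _ B1S); rewrite cS //=.
  have [cx EB] := ctrP _ B1S.
  have := link_missing_center c0 cp dF (deg _) cx; rewrite EB => cL.
  have cM : (#|missing F B1| <= 2 * #|link (ctr B1) (missing F B1)|)%N.
    by apply: card_missing_le; rewrite // -{2}EB center_in_nbhd.
  have := card_deletion_link y (missing F B1).
  by move: (2 ^ p.+2)%N #|link y _| #|deletion _ _| cL cM => E a b; lia.
have le_other B : B \in S :\ B1 -> (2 ^+ p.+1 - (c%:R - 1)) / p.+3%:R
    <= \sum_(A in F | (y \in A) && (ctr B \in A)) (#|A|%:R^-1 : rat).
  move=> /setD1P[BB1 BS]; have [cx EB] := ctrP _ BS.
  have yc : y != ctr B.
    apply: contraNneq BB1 => yc; apply/eqP; symmetry.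
    by apply: ctrS => //; rewrite -yc yS.
  have yB : y \in closed_nbhd F (ctr B) by rewrite EB yS.
  have := card_pair_link c0 cp dF (deg _) cx yB yc.
  set Q := [set A in F | _] => cQ.
  apply: (@le_trans _ _ (\sum_(A in Q) p.+3%:R^-1)).
    rewrite sumr_const -[leRHS]mulr_natl ler_pM2r ?invr_gt0 ?ltr0n //.
    rewrite -[1](mulr1n 1) -natrB // -natrX subn1 lerBlDr -natrD ler_nat; lia.
  rewrite [leRHS](eq_bigl (fun A => A \in Q)) => [|A]; last by rewrite inE.
  apply: ler_sum => A; rewrite inE => /and3P[AF yA cA].
  have A0 : (0 < #|A|)%N by apply/card_gt0P; exists y.
  rewrite lef_pV2 ?posrE ?ltr0n // ler_nat -(cS _ BS) -EB.
  exact: subset_leq_card (sub_closed_nbhd dF AF cA).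
have := ler_sum (index_enum _) le_other; rewrite sumr_const -[_ *+ _]mulr_natl.
have := cardsD1 B1 S; rewrite B1S add1n => ->.
have K0 : (0 < #|S :\ B1|)%N by have := cardsD1 B1 S; rewrite B1S; lia.
have {K0} : 1 <= #|S :\ B1|%:R :> rat by rewrite (ler_nat _ 1).
rewrite -[#|_|.+1]addn1 natrD; move: (#|S :\ B1|%:R : rat) => K K1 le_sum.
apply: le_trans (lerD leB1 le_sum).
have D0 : 0 < p.+3%:R :> rat by rewrite ltr0n.
rewrite -(ler_pM2r D0) [leRHS]mulrDl [leLHS]mulrDl mulrA !divfK ?lt0r_neq0 //.
have -> : (2 * c.-1)%:R = 2 * (c%:R - 1) :> rat.
  by rewrite natrM; congr (_ * _); rewrite -{2}(prednK c0) -natr1 addrK.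
have P5 : 5 <= p%:R :> rat by rewrite (ler_nat _ 5).
have Cp : 4 * (c%:R - 1) <= p%:R - 1 :> rat.
  have : (4 * c)%:R <= p.+3%:R :> rat by rewrite ler_nat.
  by rewrite natrM -[p.+3]addn3 natrD; lra.
have C1 : 0 <= c%:R - 1 :> rat by rewrite subr_ge0 (ler_nat _ 1).
have := cube_vs_pow2 p5; rewrite -(ler_nat rat) !(natrM, natrX, natrD) => H.
rewrite [2 ^+ p.+1]exprS -[p.+3]addn3 natrD.
have : c%:R = (c%:R - 1) + 1 :> rat by rewrite subrK.
move: (2 ^+ p : rat) (2 ^+ (p + 3) : rat) (c%:R - 1 : rat) H C1 Cp => E E3 b.
move: (p%:R : rat) P5 => P P5 H C1 Cp ->.
(* The factor [2 * P + 10] in [h2] is exactly what the final inequality requires at [K = 1]. *)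
have h1 : b * (16 * P + 80) <= 16 * E by apply: le_trans H; nra.
have h2 : 0 <= 2 * E - b * (2 * P + 10) by lra.
have h3 : 0 <= K - 1 by lra.
have := mulr_ge0 (le_trans ler01 K1) h2.
have := mulr_ge0 h3 C1.
have := mulr_ge0 (mulr_ge0 h3 C1) (le_trans (ler0n _ 5) P5).
lra.
Qed.

(** * Discharging over the blocks *)

(* Each vertex sends its excess [weight - t] to the blocks containing it. *)
Lemma downset_lower_bound (V : finType) (F : {set {set V}}) (p c : nat) :
  (5 <= p)%N -> (0 < c)%N -> (4 * c <= p.+3)%N -> downset F ->
  (forall z, 2 ^ p.+2 - c.-1 <= #|link z F|)%N ->
  #|V|%:R * ((2 ^+ p.+3 - c%:R) / p.+3%:R) <= \sum_y weight F y.
Proof.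
move=> p5 c0 cp dF deg; set t := _ / _.
have D0 : 0 < p.+3%:R :> rat by rewrite ltr0n.
have C1 : 0 <= c%:R - 1 :> rat by rewrite subr_ge0 (ler_nat _ 1).
pose K y := #|[set B in center_nbhds F p | y \in B]|.
(* The amount sent to each block, negative for a deficit; a vertex in several blocks can afford
   [c - 1] for each. *)
pose phi y := if (K y <= 1)%N then weight F y - t else c%:R - 1.
have K_phi y : (K y)%:R * phi y <= weight F y - t.
  rewrite /phi; case: leqP => [|K2]; last first.
    by rewrite lerBrDl; apply: weight_overlap.
  case E: (K y) => [|[|]] // _; last by rewrite mul1r.
  rewrite mul0r subr_ge0; apply: weight_not_center => //.
  apply/negP => cy; suff : (0 < K y)%N by rewrite E.
  apply/card_gt0P; exists (closed_nbhd F y); rewrite inE center_in_nbhd andbT.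
  by apply: imset_f; rewrite inE.
have phi_ge y : - ((c%:R - 1) / p.+3%:R) <= phi y.
  rewrite /phi; case: ifP => _.
    by rewrite lerBrDl; apply: weight_ge.
  by apply: (le_trans _ C1); rewrite oppr_le0 divr_ge0.
have block B : B \in center_nbhds F p -> 0 <= \sum_(y in B) phi y.
  move=> /imsetP[x]; rewrite inE => cx ->; set B' := closed_nbhd F x.
  have cB : #|B'| = p.+3 := card_nbhd_center c0 cp dF (deg x) cx.
  (* One vertex shared with other blocks sends [c - 1], which covers deficits of [(c - 1) / p.+3] at
     the other [p.+2] vertices. *)
  have [/exists_inP[y yB K2]|] := boolP [exists y in B', 1 < K y]%N.
    rewrite (bigD1 y) //= {1}/phi leqNgt K2 /=.
    apply: le_trans (_ : 0 <= c%:R - 1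
      + \sum_(i in B' | i != y) - ((c%:R - 1) / p.+3%:R)) _.
      rewrite (eq_bigl (fun i => i \in B' :\ y)) => [|i]; last by rewrite !inE andbC.
      rewrite sumr_const; have -> : #|B' :\ y| = p.+2.
        by have := cardsD1 y B'; rewrite yB cB => -[].
      rewrite -[- _ *+ _]mulr_natl mulrN mulrCA -{1}[_ - 1]mulr1 -mulrBr mulr_ge0 //.
      by rewrite subr_ge0 ler_pdivrMr // mul1r ler_nat.
    by rewrite lerD2l; apply: ler_sum.
  move=> /exists_inPn allK; rewrite (eq_bigr (fun y => weight F y - t)) => [|y yB].
    rewrite sumrB sumr_const cB -[_ *+ _]mulr_natl mulrC divfK ?lt0r_neq0 //.
    by rewrite subr_ge0; apply: center_nbhd_weight.
  by rewrite /phi leqNgt (allK y yB).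
rewrite -subr_ge0 mulr_natl -sumr_const -sumrB.
apply: le_trans (_ : \sum_y (K y)%:R * phi y <= _); last exact: ler_sum.
have -> : \sum_y (K y)%:R * phi y = \sum_(B in center_nbhds F p) \sum_(y in B) phi y.
  rewrite (exchange_big_dep predT) //=; apply: eq_bigr => y _.
  by rewrite mulr_natl -sumr_const; apply: eq_bigl => B; rewrite !inE.
by apply: sumr_ge0.
Qed.

Local Open Scope nat_scope.

Lemma downset_card (V : finType) (F : {set {set V}}) (d c : nat) :
  0 < c -> 4 * c <= d -> downset F -> set0 \in F ->
  (forall z, 2 ^ (d - 1) - c < #|link z F|) ->
  #|V| * (2 ^ d - c) < d * #|F|.
Proof.
move=> c0 cd dF F0 deg.
have [k dE] : exists k, d = k.+2 by exists d.-2; lia.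
have ck : c <= 2 ^ k.+1.
  by have := ltn_expl k (isT : 1 < 2); rewrite expnS; move: (2 ^ k) => E; lia.
have deg' z : 2 ^ k.+1 - c.-1 <= #|link z F|.
  by have := deg z; rewrite dE subSS subn0; move: ck; move: (2 ^ k.+1) #|_| => E l; lia.
suff H : (#|V|%:R * ((2 ^+ k.+2 - c%:R) / k.+2%:R) <= \sum_y weight F y :> rat)%R.
  have F1 : 0 < #|F| by apply/card_gt0P; exists set0.
  have ck2 : c <= 2 ^ k.+2 by apply: leq_trans ck _; rewrite leq_exp2l.
  suff : #|V| * (2 ^ d - c) <= d * (#|F| - 1).
    by rewrite dE; move: (#|V| * _) #|F| F1 => X Y; nia.
  rewrite -(ler_nat rat) !natrM !natrB // dE ?natrX //.
  move: H; rewrite sum_weight // mulrA ler_pdivrMr ?ltr0n //.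
  by rewrite [X in (_ <= X)%R]mulrC.
have sumV (t : rat) : (forall y, t <= weight F y)%R ->
    (#|V|%:R * t <= \sum_y weight F y)%R.
  by move=> ht; rewrite mulr_natl -sumr_const; apply: ler_sum.
(* For [c = 1] the deficit in [weight_ge] vanishes; [c >= 2] forces [d >= 8], that is [p >= 5]. *)
have [c1|c2] := leqP c 1.
  have E1 : c = 1 by apply/eqP; rewrite eqn_leq c1.
  apply: sumV => y.
  have := @weight_ge V F k c y c0 _ dF (deg' y).
  by rewrite -dE cd E1 subrr mul0r subr0 => /(_ isT).
have [p kE] : exists p, k = p.+1 by exists k.-1; lia.
move: deg'; rewrite kE => deg'.
by apply: downset_lower_bound => //; lia.
Qed.

(** * Compression *)

(** The usual down-compression, which removes [v] from a member [A] unless [A :\ v] is a member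
    already. *)
Definition shift (V : finType) (v : V) (F : {set {set V}}) : {set {set V}} :=
  [set A : {set V} | if v \in A then (A \in F) && (A :\ v \in F)
                     else (A \in F) || (v |: A \in F)].

Lemma deletion_shift (V : finType) (v : V) (F : {set {set V}}) :
  deletion v (shift v F) = deletion v F :|: link v F.
Proof. by apply/setP => A; rewrite !inE; case: (v \in A); rewrite ?andbT ?andbF. Qed.

Lemma link_shift (V : finType) (v : V) (F : {set {set V}}) :
  link v (shift v F) = deletion v F :&: link v F.
Proof.
apply/setP => A; rewrite inE [in LHS]inE setU11 !inE.
by case vA: (v \in A); rewrite ?andbF //= setU1K ?vA // andbT andbC.
Qed.

Lemma card_shift (V : finType) (v : V) (F : {set {set V}}) :
  #|shift v F| = #|F|.
Proof.
rewrite (card_deletion_link v) [RHS](card_deletion_link v).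
by rewrite deletion_shift link_shift cardsUI.
Qed.

(** The measure that makes compression terminate. Passing to union and intersection preserves the
    sums over deletion and link; only the number of sets through [v] drops. *)
Lemma sum_card_shift (V : finType) (v : V) (F : {set {set V}}) (A : {set V}) :
  A \in F -> v \in A -> A :\ v \notin F ->
  \sum_(B in shift v F) #|B| < \sum_(B in F) #|B|.
Proof.
move=> AF vA AvF.
have split (G : {set {set V}}) : \sum_(B in G) #|B| =
    \sum_(B in deletion v G) #|B| + \sum_(B in link v G) #|B| + #|link v G|.
  rewrite (big_deletion_link _ v) /= -addnA -[X in _ = _ + (_ + X)]sum1_card.
  rewrite -big_split; congr (_ + _); apply: eq_bigr => B.
  by rewrite !inE => /andP[vB _]; rewrite cardsU1 vB addnC.
rewrite (split (shift v F)) (split F) deletion_shift link_shift.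
set X := deletion v F; set Y := link v F.
have -> : \sum_(B in X :|: Y) #|B| + \sum_(B in X :&: Y) #|B| =
    \sum_(B in X) #|B| + \sum_(B in Y) #|B|.
  rewrite [X in X + _](big_setID X) [X in _ = _ + X](big_setID X) /=.
  by rewrite setUK setDUl setDv set0U (setIC Y) addnAC addnA.
rewrite ltn_add2l; apply: proper_card; rewrite properE subsetIr.
apply/subsetPn; exists (A :\ v); last by rewrite !inE (negbTE AvF).
by rewrite inE setD11 setD1K.
Qed.

Lemma mem_trace (V : finType) (F : {set {set V}}) (T A : {set V}) :
  A \in F -> A :&: T \in trace F T.
Proof. exact: imset_f. Qed.

(** If [v] is in [T], the trace of the shift lies in the shift of the trace; otherwise it lies in
    the trace itself. *)
Lemma card_trace_shift (V : finType) (v : V) (F : {set {set V}}) (T : {set V}) :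
  #|trace (shift v F) T| <= #|trace F T|.
Proof.
have [vT|vT] := boolP (v \in T).
  rewrite -(card_shift v (trace F T)); apply/subset_leq_card/subsetP => C.
  move=> /imsetP[A]; rewrite inE => AF ->; rewrite inE in_setI vT andbT.
  case: ifP AF => vA.
    move=> /andP[AF AvF]; rewrite mem_trace //=; apply/imsetP; exists (A :\ v) => //.
    by rewrite setIDAC.
  case/orP => AF; first by rewrite mem_trace.
  apply/orP; right; apply/imsetP; exists (v |: A) => //.
  by rewrite setIUl; congr (_ :|: _); apply/esym/setIidPl; rewrite sub1set.
apply/subset_leq_card/subsetP => C /imsetP[A]; rewrite inE => AF ->.
have E : (v |: A) :&: T = A :&: T.
  by rewrite setIUl [[set v] :&: T](_ : _ = set0) ?set0U //;
     apply/disjoint_setI0; rewrite disjoints1.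
case: ifP AF => vA; first by case/andP => AF _; apply: mem_trace.
by case/orP => AF; [|rewrite -E]; apply: mem_trace.
Qed.

Lemma downset_remove1 (V : finType) (F : {set {set V}}) :
  (forall A v, A \in F -> v \in A -> A :\ v \in F) -> downset F.
Proof.
move=> H A B; have [k] := ubnP #|A :\: B|; elim: k A => // k IH A leA AF sBA.
have [|/set0Pn[v]] := boolP (A :\: B == set0).
  by rewrite setD_eq0 => sAB; rewrite (_ : B = A) //; apply/eqP; rewrite eqEsubset sBA.
move=> vAB; have := vAB; rewrite inE => /andP[vB vA].
apply: (IH (A :\ v)); last by rewrite subsetD1 sBA.
  by have := cardsD1 v (A :\: B); rewrite vAB setDDl setUC -setDDl; lia.
exact: H.
Qed.

Lemma downset_compression (V : finType) (F : {set {set V}}) :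
  exists F' : {set {set V}}, [/\ downset F', #|F'| = #|F| &
    forall T, #|trace F' T| <= #|trace F T|].
Proof.
have [k] := ubnP (\sum_(B in F) #|B|); elim: k F => // k IH F leF.
have [/existsP[A /existsP[v /and3P[AF vA AvF]]]|no] :=
  boolP [exists A : {set V}, exists v, [&& A \in F, v \in A & A :\ v \notin F]].
  have lt := sum_card_shift AF vA AvF.
  have [F' [dF' cF' tF']] := IH (shift v F) (leq_trans lt leF).
  exists F'; split=> // [|T]; first by rewrite cF' card_shift.
  exact: leq_trans (tF' T) (card_trace_shift v F T).
exists F; split=> //; apply: downset_remove1 => A v AF vA.
apply: contraR no => AvF; apply/existsP; exists A; apply/existsP; exists v.
exact/and3P.
Qed.

(** * Traces on the complement of a vertex *)

Lemma deletion_sub_trace (V : finType) (F : {set {set V}}) (y : V) :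
  deletion y F \subset trace F (~: [set y]).
Proof.
apply/subsetP => A; rewrite inE => /andP[AF yA]; apply/imsetP; exists A => //.
by apply/esym/setIidPl; rewrite subsetC sub1set inE.
Qed.

Lemma trace_sub_deletion (V : finType) (F : {set {set V}}) (y : V) :
  downset F -> trace F (~: [set y]) \subset deletion y F.
Proof.
move=> dF; apply/subsetP => C /imsetP[A AF ->].
by rewrite inE (dF _ _ AF (subsetIl _ _)) !inE eqxx andbF.
Qed.

Lemma traceS (V : finType) (F G : {set {set V}}) (T : {set V}) :
  F \subset G -> trace F T \subset trace G T.
Proof. exact: imsetS. Qed.

Lemma subset_of_card (T : finType) (A : {set T}) (m : nat) :
  m <= #|A| -> exists2 B : {set T}, B \subset A & #|B| = m.
Proof.
move=> leA; have : 0 < #|[set B : {set T} | B \subset A & #|B| == m]|.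
  by rewrite cards_draws bin_gt0.
by case/card_gt0P => B; rewrite inE => /andP[sBA /eqP cB]; exists B.
Qed.

(** Removing a member of maximum size leaves a down-set. *)
Lemma sub_downset_card (V : finType) (F : {set {set V}}) (m : nat) :
  downset F -> m <= #|F| -> exists2 G : {set {set V}}, downset G & #|G| = m.
Proof.
move=> dF /subnKC; move: (#|F| - m) => e; elim: e F dF => [|e IH] F dF cF.
  by exists F; rewrite // -cF addn0.
have /card_gt0P[A0 A0F] : 0 < #|F| by rewrite -cF addnS.
case: (arg_maxnP (fun A : {set V} => #|A|) A0F) => A AF maxA.
apply: (IH (F :\ A)).
  move=> B C /setD1P[BA BF] CB; rewrite !inE (dF _ _ BF CB) andbT.
  apply: contraNneq BA => CA; rewrite CA in CB.
  by rewrite eq_sym eqEcard CB; apply: maxA.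
by have := cardsD1 A F; rewrite (AF : A \in F) -cF addnS => -[].
Qed.

Lemma exists_trace_ge (d c n m : nat) (V : finType) (F : {set {set V}}) :
  0 < c -> 4 * c <= d -> d %| n -> 0 < n -> #|V| = n ->
  m <= n %/ d * (2 ^ d - c) -> m <= #|F| ->
  exists2 T : {set V}, #|T| = n - 1 & m - (2 ^ (d - 1) - c) <= #|trace F T|.
Proof.
(* Exactly [m] members are kept, since [leM] bounds [m] and not [#|F|]. *)
move=> c0 cd dn n0 cV leM /subset_of_card[F0 sF0 cF0].
have [F' [dF' cF' tF']] := downset_compression F0.
have [/existsP[y leS]|] := boolP [exists y, #|link y F'| <= 2 ^ (d - 1) - c].
  exists (~: [set y]); first by rewrite cardsC1 cV subn1.
  apply: leq_trans (subset_leq_card (traceS _ sF0)).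
  apply: leq_trans (tF' _).
  apply: leq_trans (subset_leq_card (deletion_sub_trace F' y)).
  by have := card_deletion_link y F'; rewrite cF' cF0; lia.
move=> /existsPn deg; exfalso.
have deg' z : 2 ^ (d - 1) - c < #|link z F'| by rewrite ltnNge deg.
have F0' : set0 \in F'.
  have /card_gt0P[z _] : 0 < #|V| by rewrite cV.
  have /card_gt0P[A] : 0 < #|link z F'| by apply: leq_ltn_trans (deg' z).
  by rewrite inE => /andP[_]; apply: downset0.
have := downset_card c0 cd dF' F0' deg'.
rewrite cV cF' cF0 -{1}(divnK dn) mulnAC mulnC ltn_mul2l => /andP[_].
by rewrite ltnNge leM.
Qed.

(** At most [2 ^ (d - 1)] members avoid [a], so any down-set of this size has large degrees. *)
Lemma near_full_downset (d c : nat) : 0 < d -> c <= 2 ^ (d - 1) ->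
  exists G : {set {set 'I_d}}, [/\ downset G, #|G| = 2 ^ d - c &
    forall a, 2 ^ (d - 1) - c <= #|link a G|].
Proof.
move=> d0 cd.
have dP : downset (powerset [set: 'I_d]) by move=> A B _ _; rewrite inE subsetT.
have [|G dG cG] := @sub_downset_card _ (powerset [set: 'I_d]) (2 ^ d - c) dP.
  by rewrite card_powerset cardsT card_ord leq_subr.
exists G; split=> // a; have := card_deletion_link a G.
have : #|deletion a G| <= 2 ^ (d - 1).
  have -> : d - 1 = #|~: [set a]| by rewrite cardsC1 card_ord subn1.
  rewrite -card_powerset; apply/subset_leq_card/subsetP => A.
  by rewrite !inE => /andP[_ aA]; rewrite subsetC sub1set inE.
have -> : #|G| = 2 * 2 ^ (d - 1) - c by rewrite cG -expnS subn1 prednK.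
by move: cd; move: (2 ^ (d - 1)) #|_| #|_| => E a' b; lia.
Qed.

(** * The extremal family *)

Definition block_copy (I J : finType) (i : I) (A : {set J}) : {set I * J} :=
  setX [set i] A.

Definition block_union (I J : finType) (G : {set {set J}}) : {set {set I * J}} :=
  [set block_copy u.1 u.2 | u in setX [set: I] G].

Lemma in_block_copy (I J : finType) (i i' : I) (A : {set J}) (a : J) :
  ((i', a) \in block_copy i A) = (i' == i) && (a \in A).
Proof. by rewrite !inE. Qed.

Lemma block_copy_inj (I J : finType) (i i' : I) (A A' : {set J}) :
  A != set0 -> block_copy i A = block_copy i' A' -> (i, A) = (i', A').
Proof.
move=> /set0Pn[a aA] /setP E.
have ii' : i = i'.
  by have := E (i, a); rewrite !in_block_copy eqxx aA => /esym/andP[/eqP].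
congr (_, _) => //; apply/setP => b; have := E (i, b).
by rewrite !in_block_copy ii' eqxx.
Qed.

Lemma block_union_downset (I J : finType) (G : {set {set J}}) :
  downset G -> downset (block_union I G).
Proof.
move=> dG B C /imsetP[[i A]]; rewrite !inE /= => AG -> sC.
apply/imsetP; exists (i, [set a | (i, a) \in C]).
  rewrite !inE /=; apply: dG AG _; apply/subsetP => a; rewrite inE.
  by move=> /(subsetP sC); rewrite in_block_copy => /andP[].
apply/setP => -[i' a]; rewrite in_block_copy inE /=.
have [->//|ii'] := eqVneq i' i.
by apply/negP => /(subsetP sC); rewrite in_block_copy (negbTE ii').
Qed.

(** The copies of the empty set coincide; all other copies are distinct. *)
Lemma card_block_union (I J : finType) (G : {set {set J}}) :
  0 < #|I| -> set0 \in G -> #|block_union I G| = (#|I| * (#|G| - 1)).+1.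
Proof.
move=> I0 G0; have /card_gt0P[i0 _] := I0.
have -> : block_union I G =
    set0 |: [set block_copy u.1 u.2 | u in setX [set: I] (G :\ set0)].
  apply/setP => B; rewrite in_setU1; apply/imsetP/orP.
    move=> [[i A]]; rewrite !inE /= => AG ->.
    have [A0|A0] := eqVneq A set0; [left|right].
      by apply/eqP/setP => -[i' a]; rewrite in_block_copy A0 !inE andbF.
    by apply/imsetP; exists (i, A); rewrite // !inE /= A0.
  case=> [/eqP ->|/imsetP[[i A]]].
    exists (i0, set0); first by rewrite !inE.
    by apply/setP => -[i' a]; rewrite in_block_copy !inE andbF.
  by rewrite !inE /= => /andP[_ AG] ->; exists (i, A); rewrite ?inE.
rewrite cardsU1 card_in_imset; last first.
  move=> [i A] [i' A']; rewrite !inE /= => /andP[A0 _] _.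
  exact: block_copy_inj.
rewrite cardsX cardsT (cardsD1 set0 G) G0 add1n subn1 /= -add1n; congr (_ + _).
rewrite (_ : set0 \notin _) //; apply/imsetP => -[[i A]].
rewrite !inE /= => /andP[/set0Pn[a aA] _] /setP /(_ (i, a)).
by rewrite in_block_copy eqxx aA inE.
Qed.

Lemma link_block_union (I J : finType) (G : {set {set J}}) (i : I) (a : J) :
  #|link a G| <= #|link (i, a) (block_union I G)|.
Proof.
have inj : injective (@block_copy I J i).
  move=> A A' /setP E; apply/setP => b; have := E (i, b).
  by rewrite !in_block_copy eqxx.
rewrite -(card_imset _ inj); apply/subset_leq_card/subsetP => B /imsetP[A].
rewrite inE => /andP[aA AG] ->; rewrite inE in_block_copy (negbTE aA) andbF /=.
apply/imsetP; exists (i, a |: A); first by rewrite !inE.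
apply/setP => -[i' b]; rewrite in_setU1 !in_block_copy in_setU1 xpair_eqE.
by case: (i' == i).
Qed.

Lemma extremal_family (d c n : nat) :
  0 < d -> 0 < c -> c <= 2 ^ (d - 1) -> d %| n -> 0 < n ->
  exists (V : finType) (F : {set {set V}}), [/\ #|V| = n, downset F,
    #|F| = (n %/ d * (2 ^ d - c)).+1 &
    forall y, 2 ^ (d - 1) - c < #|link y F|].
Proof.
move=> d0 c0 cd dn n0.
(* With [c.-1] in place of [c], each block contributes [2 ^ d - c] nonempty members besides the
   shared empty set. *)
have [|G [dG cG deg]] := @near_full_downset d c.-1 d0; first by lia.
have E2 : 2 ^ d = 2 * 2 ^ (d - 1) by rewrite -expnS subn1 prednK.
have G0 : set0 \in G.
  have /card_gt0P[A AG] : 0 < #|G|.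
    by rewrite cG E2; move: cd; move: (2 ^ _) => E; lia.
  exact: downset0 dG AG.
exists ('I_(n %/ d) * 'I_d)%type, (block_union _ G); split.
- by rewrite card_prod !card_ord divnK.
- exact: block_union_downset.
- rewrite card_block_union ?card_ord // ?divn_gt0 ?(dvdn_leq n0) // cG.
  by congr (_ * _).+1; lia.
- move=> [i a]; apply: leq_trans (link_block_union G i a).
  by apply: leq_trans (deg a); move: cd; move: (2 ^ _) => E; lia.
Qed.

Theorem mainTheorem1 (d c n : nat) (hd : 0 < d) (hc : 0 < c) (hn : 0 < n)
  (hdc : 4 * c <= d) (hdn : d %| n) :
  is_m n (2 ^ (d - 1) - c) (n %/ d * (2 ^ d - c)).
Proof.
split=> [m leM V cV F leF|M' upto]; first exact: exists_trace_ge leM leF.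
have E2 : 2 ^ d = 2 * 2 ^ (d - 1) by rewrite -expnS subn1 prednK.
have cd : c <= 2 ^ (d - 1).
  by have := ltn_expl (d - 1) (isT : 1 < 2); lia.
have [V [F [cV dF cF deg]]] := extremal_family hd hc cd hdn hn.
(* A larger value would apply to the extremal family, yet every [T] of size [n - 1] omits one
   vertex, whose degree exceeds [2 ^ (d - 1) - c]. *)
rewrite leqNgt; apply/negP => ltM.
have [|T cT] := upto _ ltM V cV F; first by rewrite cF.
have /eqP/cards1P[y yT] : #|~: T| = 1 by rewrite cardsCs setCK cV cT; lia.
have -> : T = ~: [set y] by rewrite -yT setCK.
apply/negP; rewrite -ltnNge.
apply: leq_ltn_trans (subset_leq_card (trace_sub_deletion y dF)) _.
have := card_deletion_link y F; rewrite cF; have := deg y.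
have : 2 ^ d - c <= n %/ d * (2 ^ d - c).
  by rewrite leq_pmull // divn_gt0 // dvdn_leq.
move: (2 ^ (d - 1)) (2 ^ d) (n %/ d * _) #|_| #|_| E2 => E E' M a b; lia.
Qed.
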